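(* Let $K$ be a field and let $M$ be the Chinese monoid of rank $n\ge 1$. Then the number of minimal prime ideals of the algebra $K[M]$ is equal to $T_n$, where $(T_k)_{k\ge 0}$ is the Tribonacci sequence given by $T_0=T_1=T_2=1$ and $T_{k+1}=T_k+T_{k-1}+T_{k-2}$ for $k\ge 2$.
   Context: The Chinese monoid of rank $n$ is the monoid $M=\langle a_1,\dots,a_n\rangle$ defined by the relations $a_ja_ia_k=a_ja_ka_i=a_ka_ja_i$ for $i\le k\le j$; $K[M]$ is its monoid algebra over $K$. *)

(* Defs.v *)
From HB Require Import structures.
From mathcomp Require Import all_boot all_algebra.
From mathcomp Require Import boolp classical_sets cardinality.
From mathcomp Require Import monalg.

Set Implicit Arguments.
Unset Strict Implicit.
Unset Printing Implicit Defensive.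

Local Open Scope quotient_scope.

(* The generators a_1, ..., a_n are indexed from 0 by 'I_n; the elements of the
   free monoid are the words over 'I_n, with concatenation as product. *)
Inductive chinese_rel (n : nat) : seq 'I_n -> seq 'I_n -> Prop :=
| ChineseJIK (i k j : 'I_n) :
    i <= k -> k <= j -> chinese_rel [:: j; i; k] [:: j; k; i]
| ChineseJKI (i k j : 'I_n) :
    i <= k -> k <= j -> chinese_rel [:: j; k; i] [:: k; j; i].

Inductive chinese_cong (n : nat) : seq 'I_n -> seq 'I_n -> Prop :=
| ChineseRel u v : chinese_rel u v -> chinese_cong u v
| ChineseRefl u : chinese_cong u u
| ChineseSym u v : chinese_cong u v -> chinese_cong v u
| ChineseTrans u v w :
    chinese_cong u v -> chinese_cong v w -> chinese_cong u w
| ChineseCat u u' v v' :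
    chinese_cong u u' -> chinese_cong v v' -> chinese_cong (u ++ v) (u' ++ v').

Section ChineseMonoid.
Variable n : nat.

Definition chinese_eq : rel (seq 'I_n) := fun u v => `[< chinese_cong u v >].

Lemma chinese_eqP u v : reflect (chinese_cong u v) (chinese_eq u v).
Proof. exact: asboolP. Qed.

Lemma chinese_eq_refl : reflexive chinese_eq.
Proof. by move=> u; apply/chinese_eqP; apply: ChineseRefl. Qed.

Lemma chinese_eq_sym : symmetric chinese_eq.
Proof.
by move=> u v; apply/chinese_eqP/chinese_eqP => h; apply: ChineseSym.
Qed.

Lemma chinese_eq_trans : transitive chinese_eq.
Proof.
move=> v u w /chinese_eqP uv /chinese_eqP vw; apply/chinese_eqP.
exact: ChineseTrans uv vw.
Qed.

Canonical chinese_equiv :=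
  EquivRel chinese_eq chinese_eq_refl chinese_eq_sym chinese_eq_trans.

Definition chinese_monoid := {eq_quot chinese_equiv}.

HB.instance Definition _ := Choice.on chinese_monoid.
HB.instance Definition _ := EqQuotient.on chinese_monoid.

Definition chinese_one : chinese_monoid := \pi_chinese_monoid [::].

Definition chinese_mul (x y : chinese_monoid) : chinese_monoid :=
  \pi_chinese_monoid (repr x ++ repr y).

Lemma chinese_piP u v :
  \pi_chinese_monoid u = \pi_chinese_monoid v <-> chinese_cong u v.
Proof.
by split => [/eqmodP/chinese_eqP|h] //; apply/eqmodP/chinese_eqP.
Qed.

Lemma chinese_cong_size u v : @chinese_cong n u v -> size u = size v.
Proof.
elim=> {u v} [u v []||u v _|u v w _ -> _ ->|u u' v v' _ eu _ ev] //.
by rewrite !size_cat eu ev.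
Qed.

Lemma chinese_mul_pi u v :
  chinese_mul (\pi_chinese_monoid u) (\pi_chinese_monoid v) =
  \pi_chinese_monoid (u ++ v).
Proof.
by apply/chinese_piP; apply: ChineseCat; apply/chinese_piP; rewrite reprK.
Qed.

Lemma chinese_mulA : associative chinese_mul.
Proof.
elim/quotW=> u; elim/quotW=> v; elim/quotW=> w.
by rewrite (chinese_mul_pi v w) (chinese_mul_pi u v) !chinese_mul_pi catA.
Qed.

Lemma chinese_mul1m : left_id chinese_one chinese_mul.
Proof. by elim/quotW=> u; rewrite (chinese_mul_pi [::] u). Qed.

Lemma chinese_mulm1 : right_id chinese_one chinese_mul.
Proof. by elim/quotW=> u; rewrite (chinese_mul_pi u [::]) cats0. Qed.

Lemma chinese_unitm x y :
  chinese_mul x y = chinese_one -> x = chinese_one /\ y = chinese_one.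
Proof.
elim/quotW: x => u; elim/quotW: y => v.
rewrite (chinese_mul_pi u v) => /chinese_piP/chinese_cong_size.
by case: u v => [|? ?] [|? ?].
Qed.

HB.instance Definition _ := Choice_isMonomialDef.Build chinese_monoid
  chinese_mulA chinese_mul1m chinese_mulm1 chinese_unitm.

End ChineseMonoid.

Section PrimeIdeals.
Variable R : nzRingType.
Local Open Scope ring_scope.
Local Open Scope classical_set_scope.

(* Closure under opposites is the case a = -1 of [ideal_mull]. *)
Record two_sided_ideal (I : set R) : Prop := TwoSidedIdeal {
  ideal0 : I 0;
  idealD : forall x y, I x -> I y -> I (x + y);
  ideal_mull : forall a x, I x -> I (a * x);
  ideal_mulr : forall x a, I x -> I (x * a) }.

(* As P is closed under sums, [forall x y, I x -> J y -> P (x * y)] says that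
   the product ideal IJ is contained in P. *)
Record prime_ideal (P : set R) : Prop := PrimeIdeal {
  prime_ideal_ideal : two_sided_ideal P;
  prime_ideal_proper : P <> setT;
  prime_ideal_mul : forall I J : set R,
    two_sided_ideal I -> two_sided_ideal J ->
    (forall x y, I x -> J y -> P (x * y)) -> I `<=` P \/ J `<=` P }.

Definition minimal_prime_ideal (P : set R) : Prop :=
  prime_ideal P /\ forall Q : set R, prime_ideal Q -> Q `<=` P -> Q = P.

End PrimeIdeals.

Fixpoint tribonacci (k : nat) : nat :=
  match k with
  | ((k0.+1 as k1).+1 as k2).+1 => tribonacci k2 + tribonacci k1 + tribonacci k0
  | _ => 1
  end.

(* Main.v *)
Require Import Defs.
From HB Require Import structures.
From mathcomp Require Import all_boot all_algebra.
From mathcomp Require Import (coercions, canonicals) mpoly.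
From mathcomp Require Import boolp classical_sets cardinality.
From mathcomp Require Import finmap.
From mathcomp Require Import monalg zify.

(* Every arc (s, t) with s < t gives a homomorphism from the Chinese monoid to
   the bicyclic monoid <p, q | p q = 1>: generators >= t (the openers) go to p,
   generators <= s (the closers) go to q, the others to 1.  Together with the numbers of occurrences of
   the generators, these homomorphisms separate the points of the monoid.  For
   a set G of arcs, let P(G) be the kernel of K[M] -> K[B^G x Z^n].
   - If two arcs a, b of G are not strictly nested, with a to the left of b, then
     P(G - b) P(G - a) is contained in P(G): in a product x y either the
     unmatched openers of x absorb all closers of y, or conversely, and for
     non-nested arcs one of the two coordinates is therefore always determined
     by the other data.  As P(all arcs) = 0, every prime contains P(C) for some
     family C of pairwise strictly nested arcs.
   - For such a family C the ideal P(C) is prime, because the image of M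
     contains, up to central factors, all the coordinate elements p and q.
   - P(C) <= P(D) forces D <= C.
   Hence the minimal primes correspond to the maximal nested families.  The
   outermost arc (s, t) of a maximal family satisfies s = 1 or t = n, and the
   remaining arcs form a maximal family strictly between s and t; this gives
   the Tribonacci recursion. *)

Set Implicit Arguments.
Unset Strict Implicit.
Unset Printing Implicit Defensive.

Import GRing.Theory.

(** * Bicyclic invariants of words *)

Section Bicyclic.

(* The pair (a, b) stands for the element q^a p^b, where p q = 1. *)
Definition bmul (p q : nat * nat) : nat * nat :=
  (p.1 + (q.1 - p.2), q.2 + (p.2 - q.1)).

Lemma bmulA : associative bmul.
Proof. by move=> [a b] [c d] [e f]; rewrite /bmul /=; congr pair; lia. Qed.

Lemma bmul1p : left_id (0, 0) bmul.
Proof. by move=> [a b]; rewrite /bmul /=; congr pair; lia. Qed.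

Variable n : nat.
Implicit Types (a : 'I_n * 'I_n) (u v w : seq 'I_n) (x : 'I_n).

(* For the arc a = (s, t): q on letters <= s, p on letters >= t.  This makes
   sense, and is compatible with the Chinese relations, only if s < t. *)
Definition bic_letter a x : nat * nat := ((x <= a.1) : nat, (a.2 <= x) : nat).

Definition bic a w : nat * nat := foldr (fun x => bmul (bic_letter a x)) (0, 0) w.

Lemma bic_cat a u v : bic a (u ++ v) = bmul (bic a u) (bic a v).
Proof. by elim: u => [|x u IH] /=; rewrite ?bmul1p // IH bmulA. Qed.

(** In all three words of the relations [j] precedes [i]: an opener [j] and a closer [i] cancel and
    leave the image of [k]. Otherwise no closer or no opener occurs, and the images commute. *)
Lemma bic_rel a u v : a.1 < a.2 -> chinese_rel u v -> bic a u = bic a v.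
Proof.
case: a => [s t] /= lt_st [i k j ik kj|i k j ik kj]; rewrite /bic /bic_letter /bmul /=.
all: case: (leqP i s) => hi; case: (leqP k s) => hk; case: (leqP j s) => hj;
  case: (leqP t i) => hi'; case: (leqP t k) => hk'; case: (leqP t j) => hj' //;
  exfalso; lia.
Qed.

Lemma bic_cong a u v : a.1 < a.2 -> chinese_cong u v -> bic a u = bic a v.
Proof.
move=> lt_a; elim=> {u v} [u v||u v _ ->|u v w _ -> _ ->|u u' v v' _ e _ e'] //.
  exact: bic_rel.
by rewrite !bic_cat e e'.
Qed.

Lemma chinese_cong_perm u v : chinese_cong u v -> perm_eq u v.
Proof.
elim=> {u v} [u v|u|u v _|u v w _ h _ h'|u u' v v' _ h _ h'] //.
- by case=> [i k j _ _|i k j _ _]; apply/permP => p /=; lia.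
- by rewrite perm_sym.
- exact: perm_trans h h'.
- exact: perm_cat.
Qed.

Lemma bic_balance a w :
  (bic a w).1 + count (fun x : 'I_n => a.2 <= x) w
  = (bic a w).2 + count (fun x : 'I_n => x <= a.1) w.
Proof.
elim: w => //= x w; case: (bic a w) => c d /=; rewrite /bic_letter /=.
by case: (x <= _); case: (_ <= x) => /=; lia.
Qed.

Lemma bic_le_size a w : (bic a w).2 <= size w.
Proof.
elim: w => //= x w; case: (bic a w) => c d; rewrite /bic_letter /=; lia.
Qed.

(* Moving both ends of an arc to the left makes more letters opening and fewer
   letters closing. *)
Lemma bic_mono a (b : 'I_n * 'I_n) w : a.1 <= b.1 -> a.2 <= b.2 ->
  (bic a w).1 <= (bic b w).1 /\ (bic b w).2 <= (bic a w).2.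
Proof.
move=> h1 h2; elim: w => //= x w.
case: (bic a w) (bic b w) => c d [c' d'] /= [? ?]; rewrite /bic_letter /=; lia.
Qed.

End Bicyclic.

(** * Normal form of words and faithfulness of the invariants *)

Section Faithful.
Variable n : nat.
Implicit Types (a : 'I_n * 'I_n) (u v w r : seq 'I_n) (x y o : 'I_n).

Lemma cong_catl w u v : chinese_cong u v -> chinese_cong (w ++ u) (w ++ v).
Proof. exact/ChineseCat/ChineseRefl. Qed.

Lemma cong_catr w u v : chinese_cong u v -> chinese_cong (u ++ w) (v ++ w).
Proof. by move=> h; apply: ChineseCat h (ChineseRefl _). Qed.

(** Blocks with a fixed [o] and [x <= o] commute in the monoid. A word with letters at most [o] is
    congruent to a word in smaller letters followed by a row of blocks, a normal form by recursion
    on the largest letter. *)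
Definition block o x : seq 'I_n := if x < o then [:: o; x] else [:: o].

Definition block_row o r : seq 'I_n := flatten (map (block o) r).

Lemma block_row_rcons o r x : block_row o (rcons r x) = block_row o r ++ block o x.
Proof. by rewrite /block_row map_rcons flatten_rcons. Qed.

Lemma blockC o x y : x <= y -> y <= o ->
  chinese_cong (block o x ++ block o y) (block o y ++ block o x).
Proof.
move=> xy yo; rewrite /block; case: ltnP => [xo|ox]; last first.
  by rewrite (_ : (y < o) = false); [apply: ChineseRefl | lia].
have oxo : chinese_cong [:: o; x; o] [:: o; o; x].
  by apply/ChineseRel/ChineseJIK; lia.
case: ltnP => [yo'|oy]; last exact: oxo.
apply: (ChineseTrans (cong_catr [:: y] oxo)).
apply: (cong_catl [:: o] (v := [:: y; o; x])).
apply: (ChineseTrans (v := [:: o; y; x])).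
  exact/ChineseRel/ChineseJIK.
exact/ChineseRel/ChineseJKI.
Qed.

Lemma block_row_block o x r : x <= o -> all (fun y : 'I_n => y <= o) r ->
  chinese_cong (block_row o r ++ block o x) (block o x ++ block_row o r).
Proof.
move=> xo; elim: r => [|y r IH] /=; first by rewrite cats0 => _; apply: ChineseRefl.
case/andP=> yo ro; rewrite -/(block_row o r) -catA.
apply: (ChineseTrans (cong_catl _ (IH ro))); rewrite !catA; apply: cong_catr.
by case: (leqP x y) => xy; [apply/ChineseSym|]; apply: blockC => //; lia.
Qed.

Lemma block_row_perm o r r' : all (fun y : 'I_n => y <= o) r ->
  perm_eq r r' -> chinese_cong (block_row o r) (block_row o r').
Proof.
elim: r r' => [|x r IH] r'.
  by rewrite perm_sym => _ /perm_nilP ->; apply: ChineseRefl.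
case/andP=> xo ro er.
have := perm_mem er x; rewrite mem_head => /esym xr'.
move: er; case/splitPr: xr' => r1 r2 er.
have er0 : perm_eq r (r1 ++ r2).
  by rewrite -(perm_cons x) (perm_trans er) // -cat_rcons -cat_cons perm_cat2r
     perm_rcons.
have /allP r'o : all (fun y : 'I_n => y <= o) (r1 ++ r2).
  by rewrite -(perm_all _ er0).
apply: (ChineseTrans (cong_catl (block o x) (IH _ ro er0))).
rewrite /block_row !map_cat !flatten_cat /= !catA; apply: cong_catr.
apply/ChineseSym/block_row_block => //; apply/allP => y yr1.
by apply: r'o; rewrite mem_cat yr1.
Qed.

(* The last block o y either swallows x, expelling the larger letter y to the
   left, or commutes with x. *)
Lemma block_row_insert o r x : all (fun y : 'I_n => y <= o) r -> x < o ->
  exists w r', [/\ all (fun y : 'I_n => y < o) w, all (fun y : 'I_n => y <= o) r'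
    & chinese_cong (block_row o r ++ [:: x]) (w ++ block_row o r')].
Proof.
elim/last_ind: r x => [|r y IH] x.
  by move=> _ xo; exists [:: x], [::]; rewrite /= xo; split=> //; apply: ChineseRefl.
rewrite all_rcons => /andP[yo ro] xo; rewrite block_row_rcons.
case: (ltnP y o) => [yo'|oy]; last first.
  exists [::], (rcons r x); rewrite all_rcons ro ltnW // block_row_rcons.
  by split=> //; rewrite /block xo ltnNge oy -catA; apply: ChineseRefl.
have [z zz [t to eq_z]] : exists2 z : 'I_n, z < o &
    exists2 t : 'I_n, t < o &
    chinese_cong (block o y ++ [:: x]) (z :: block o t).
  rewrite /block yo'; case: (leqP y x) => xy.
    exists x => //; exists y => //; rewrite yo'.
    by apply: (ChineseTrans (v := [:: o; x; y])); apply/ChineseRel;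
      [apply: ChineseJIK => //; lia | apply: ChineseJKI => //; lia].
  exists y => //; exists x => //; rewrite xo.
  by apply/ChineseRel/ChineseJKI; lia.
have [w [r' [wo r'o eq_w]]] := IH z ro zz.
exists w, (rcons r' t); rewrite all_rcons r'o ltnW //; split=> //.
rewrite block_row_rcons -catA; apply: (ChineseTrans (cong_catl _ eq_z)).
by rewrite -cat1s !catA; apply: cong_catr.
Qed.

Lemma block_row_decomp o w : all (fun y : 'I_n => y <= o) w ->
  exists w' r, [/\ all (fun y : 'I_n => y < o) w', all (fun y : 'I_n => y <= o) r
    & chinese_cong w (w' ++ block_row o r)].
Proof.
elim/last_ind: w => [|w x IH].
  by exists [::], [::]; split=> //; apply: ChineseRefl.
rewrite all_rcons => /andP[xo /IH[w1 [r [w1o ro eq_w]]]].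
case: (ltnP x o) => [xo'|ox]; last first.
  exists w1, (rcons r x); rewrite all_rcons xo ro; split=> //.
  rewrite -cats1 block_row_rcons /block ltnNge ox catA.
  have -> : [:: o] = [:: x] by congr cons; apply: val_inj => /=; lia.
  exact: cong_catr.
have [w2 [r2 [w2o r2o eq_r]]] := block_row_insert ro xo'.
exists (w1 ++ w2), r2; rewrite all_cat w1o w2o; split=> //.
rewrite -cats1; apply: (ChineseTrans (cong_catr _ eq_w)).
by rewrite -!catA; apply: cong_catl.
Qed.

Lemma bic_block_row1 a o r : a.1 < a.2 -> a.2 <= o -> (bic a (block_row o r)).1 = 0.
Proof.
move=> lt_a ao; elim: r => //= x r IH; rewrite bic_cat.
move: IH; rewrite /row; case: (bic a _) => c d /= ->.
by rewrite /block; case: (x < o); rewrite /bic_letter /=; lia.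
Qed.

(** A block [o x] with [x <= a.1] cancels, and every other block leaves one unmatched opener. Hence
    the arcs ending at [o], together with the size of [r], recover the multiset [r]. *)
Lemma bic_block_row2 a o r : a.1 < a.2 -> a.2 = o ->
  (bic a (block_row o r)).2 = count (fun x : 'I_n => a.1 < x) r.
Proof.
move=> lt_a ao; elim: r => //= x r IH; rewrite bic_cat.
have := @bic_block_row1 a o r lt_a; move: IH; rewrite /row.
case: (bic a _) => c d /= -> ->; last by rewrite ao.
by rewrite /block -ao; case: (ltnP x a.2) => h; rewrite /bic_letter /=; lia.
Qed.

Lemma bic_small2 a w : all (fun x : 'I_n => x < a.2) w -> (bic a w).2 = 0.
Proof.
elim: w => //= x w IH /andP[xa /IH]; case: (bic a w) => c d /= ->.
by rewrite /bic_letter /=; lia.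
Qed.

Lemma count_block_row o r : count_mem o (block_row o r) = size r.
Proof.
elim: r => //= x r IH; rewrite /block_row /= count_cat -/(block_row o r) IH.
rewrite /block; case: ltnP => xo /=; rewrite eqxx //.
by have -> : (x == o) = false by apply/eqP => e; move: xo; rewrite e ltnn.
Qed.

Lemma perm_eq_count_leq r r' :
  (forall j : nat, count (fun x : 'I_n => j <= x) r
     = count (fun x : 'I_n => j <= x) r') -> perm_eq r r'.
Proof.
move=> h; apply/allP => i _ /=; apply/eqP.
have E s : count (fun x : 'I_n => i <= x) s
    = count_mem i s + count (fun x : 'I_n => i.+1 <= x) s.
  elim: s => //= x s ->; rewrite -val_eqE /=; lia.
by have := h i; rewrite !E h => /addIn.
Qed.

(** Induction on a bound for the letters: both words are put in normal form for the largest letter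
    [o], their rows agree up to permutation, and the remainders are compared in smaller letters. *)
Lemma chinese_faithful u v : perm_eq u v ->
  (forall a, a.1 < a.2 -> (bic a u).2 = (bic a v).2) -> chinese_cong u v.
Proof.
move=> puv huv.
have key : forall (m : nat) u v,
    all (fun x : 'I_n => x < m) u -> all (fun x : 'I_n => x < m) v ->
    perm_eq u v -> (forall a, a.1 < a.2 -> (bic a u).2 = (bic a v).2) ->
    chinese_cong u v; last first.
  by apply: (key n) => //; apply/allP => x _; apply: ltn_ord.
move=> {u v puv huv}; elim=> [|m IH] u v um vm puv huv.
  case: u v um vm puv {huv} => [|x u] [|y v] //= _ _ _; exact: ChineseRefl.
case: (ltnP m n) => [mn|nm]; last first.
  by apply: IH => //; apply/allP => x _; apply: leq_trans (ltn_ord x) nm.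
pose o := Ordinal mn.
have [u' [r [u'o ro eq_u]]] := @block_row_decomp o u um.
have [v' [r' [v'o r'o eq_v]]] := @block_row_decomp o v vm.
have eq_b a : a.1 < a.2 -> (bic a (u' ++ block_row o r)).2 = (bic a (v' ++ block_row o r')).2.
  by move=> lt_a; rewrite -(bic_cong lt_a eq_u) -(bic_cong lt_a eq_v) huv.
have eq_p : perm_eq (u' ++ block_row o r) (v' ++ block_row o r').
  rewrite -(permPl (chinese_cong_perm eq_u)) (perm_trans puv) //.
  exact: chinese_cong_perm.
have no_o w : all (fun y : 'I_n => y < o) w -> count_mem o w = 0.
  move=> /allP wo; apply/count_memPn/negP => /wo; by rewrite ltnn.
have perm_r : perm_eq r r'.
  (* Threshold 0 gives the size of the row, which is the number of letters [o]; threshold [j.+1]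
     with [j < m] is read off from the arc [(j, o)]. *)
  apply: perm_eq_count_leq => -[|j].
    rewrite !(eq_count (a2 := predT)) // !count_predT.
    have /permP/(_ (pred1 o)) := eq_p.
    by rewrite !count_cat (no_o _ u'o) (no_o _ v'o) !count_block_row.
  case: (ltnP j m) => jm; last first.
    have E s : all (fun y : 'I_n => y <= o) s -> count (fun x : 'I_n => j < x) s = 0.
      elim: s => //= y s IHs /andP[yo /IHs ->].
      by rewrite addn0; apply/eqP; rewrite eqb0 -leqNgt (leq_trans yo).
    by rewrite !E.
  pose a := (Ordinal (ltn_trans jm mn), o).
  have lt_a : a.1 < a.2 by [].
  have := eq_b a lt_a; rewrite !bic_cat /bmul /=.
  rewrite (@bic_small2 a _ u'o) (@bic_small2 a _ v'o).
  by rewrite !sub0n !addn0 !bic_block_row2.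
have row_rr' := block_row_perm ro perm_r.
apply: (ChineseTrans eq_u); apply/ChineseSym/(ChineseTrans eq_v)/ChineseSym.
apply: ChineseCat => //; apply: IH => //.
  rewrite -(perm_cat2r (block_row o r')); apply: perm_trans eq_p.
  by rewrite perm_cat2l perm_sym chinese_cong_perm.
(* If [o <= a.2], the words without [o] contain no opener. Otherwise the row has no unmatched
   closer, so its openers are simply added and can be cancelled. *)
move=> a lt_a; case: (leqP o a.2) => oa.
  have le_o w : all (fun y : 'I_n => y < o) w -> all (fun y : 'I_n => y < a.2) w.
    by apply: sub_all => y /= yo; apply: leq_trans yo oa.
  by rewrite !bic_small2 ?le_o.
have := eq_b a lt_a; rewrite !bic_cat /bmul /= (bic_cong lt_a row_rr').
by rewrite !bic_block_row1 ?subn0 //; [lia|exact: ltnW].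
Qed.

End Faithful.

(** * Generating polynomials and the ideals P(G) *)

Section MonoidInvariants.
Variable n : nat.
Local Notation M := (chinese_monoid n).
Local Notation arc := ('I_n * 'I_n)%type.
Implicit Types (a b : arc) (x y : M) (u v w : seq 'I_n).
Local Open Scope quotient_scope.

Definition mbic a x := bic a (repr x).

Definition content x : mpoly.multinom n :=
  mpoly.Multinom [tuple count_mem i (repr x) | i < n].

Lemma repr_pi u : chinese_cong (repr (\pi_M u)) u.
Proof. by apply/chinese_piP; rewrite reprK. Qed.

Lemma mbic_pi a u : a.1 < a.2 -> mbic a (\pi_M u) = bic a u.
Proof. by move=> lt_a; apply/bic_cong/repr_pi. Qed.

Lemma mbicM a x y : a.1 < a.2 -> mbic a (mmul x y) = bmul (mbic a x) (mbic a y).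
Proof.
move=> lt_a; rewrite -[mmul x y]/(chinese_mul x y) /chinese_mul.
by rewrite mbic_pi // bic_cat.
Qed.

Lemma contentE x i : content x i = count_mem i (repr x).
Proof. by rewrite mpoly.multinomE tnth_mktuple. Qed.

Lemma content_pi u i : content (\pi_M u) i = count_mem i u.
Proof. by rewrite contentE; apply/permP/chinese_cong_perm/repr_pi. Qed.

Lemma contentM x y : content (mmul x y) = mpoly.mnm_add (content x) (content y).
Proof.
apply/mpoly.mnmP => i; rewrite mpoly.mnmDE -[mmul x y]/(chinese_mul x y).
by rewrite content_pi count_cat !contentE.
Qed.

Lemma mbic_faithful x y : content x = content y ->
  (forall a, a.1 < a.2 -> (mbic a x).2 = (mbic a y).2) -> x = y.
Proof.
move=> eq_c eq_b; rewrite -[x]reprK -[y]reprK; apply/chinese_piP.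
apply: chinese_faithful => //; apply/allP => i _ /=.
by rewrite -!contentE eq_c.
Qed.

Definition openers a (k : mpoly.multinom n) := \sum_(i : 'I_n | a.2 <= i) k i.
Definition closers a (k : mpoly.multinom n) := \sum_(i : 'I_n | i <= a.1) k i.

Lemma count_content (p : pred 'I_n) x : count p (repr x) = \sum_(i | p i) content x i.
Proof.
under eq_bigr => i _ do rewrite contentE.
elim: (repr x) => [|y w IH] /=; first by rewrite big1.
rewrite big_split /= -IH; congr addn.
rewrite big_mkcond (bigD1 y) //= eqxx big1 ?addn0; first by case: (p y).
by move=> i; rewrite eq_sym => /negPf ->; case: (p i).
Qed.

Lemma mbic_balance a x : (mbic a x).1 + openers a (content x)
  = (mbic a x).2 + closers a (content x).
Proof. by rewrite /openers /closers -!count_content bic_balance. Qed.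

End MonoidInvariants.

(** * Linear maps out of a monoid algebra *)

Section LinearExtension.
Local Open Scope ring_scope.
Variables (K : fieldType) (M : monomType) (V : lmodType K) (h : M -> V).
Implicit Types f g : {malg K[M]}.

Definition lin f : V := \sum_(x <- msupp f) f@_x *: h x.

Lemma linw (d : {fset M}) f : (msupp f `<=` d)%fset ->
  lin f = \sum_(x <- d) f@_x *: h x.
Proof.
move=> le; rewrite /lin [LHS](big_fset_incl _ le) => //= x xd /mcoeff_outdom ->.
by rewrite scale0r.
Qed.

Lemma lin_is_linear : linear lin.
Proof.
move=> c f g; pose d := (msupp (c *: f + g) `|` (msupp f `|` msupp g))%fset.
have le_f : (msupp f `<=` d)%fset by rewrite /d fsubsetU // fsubsetUl orbT.
have le_g : (msupp g `<=` d)%fset by rewrite /d fsubsetU // fsubsetUr orbT.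
rewrite (linw (fsubsetUl _ _ : (_ `<=` d)%fset)) (linw le_f) (linw le_g).
rewrite scaler_sumr -big_split /=; apply: eq_bigr => x _.
by rewrite mcoeffD mcoeffZ scalerDl scalerA.
Qed.

HB.instance Definition _ :=
  GRing.isLinear.Build K {malg K[M]} V *:%R lin lin_is_linear.

Lemma linU c x : lin << c *g x >> = c *: h x.
Proof. by rewrite (linw msuppU_le) big_seq_fset1 mcoeffUU. Qed.

End LinearExtension.

Lemma lin_eq (K : fieldType) (M : monomType) (V : lmodType K) (h h' : M -> V)
  (f : {malg K[M]}) : {in msupp f, h =1 h'} -> lin h f = lin h' f.
Proof. by move=> e; apply: eq_big_seq => x xf; rewrite e. Qed.

Lemma linM (K : fieldType) (M : monomType) (V : lmodType K) (h : M -> V)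
  (f g : {malg K[M]}) :
  lin h (f * g)%R = lin (fun y => lin (fun x => h (mmul x y)) f) g.
Proof.
rewrite malgME linear_sum /=.
under eq_bigr => x _ do rewrite linear_sum /=.
rewrite exchange_big [RHS]/lin; apply: eq_bigr => y _ /=.
rewrite [X in _ = GRing.scale _ X]/lin scaler_sumr; apply: eq_bigr => x _ /=.
by rewrite linU scalerA mulrC.
Qed.

(** * The ideals P(G) through generating polynomials *)

Section GeneratingPolynomials.
Local Open Scope ring_scope.
Variables (K : fieldType) (n : nat).
Local Notation M := (chinese_monoid n).
Local Notation A := {malg K[chinese_monoid n]}.
Local Notation arc := ('I_n * 'I_n)%type.
Local Notation pol := (mpoly.mpoly n K).
Implicit Types (a b : arc) (x y : M) (G : {set arc}) (mu nu : arc -> nat).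
Implicit Types (f g : A).

Definition arcs : {set arc} := [set a : arc | (a.1 < a.2)%N].

Definition below G mu x := [forall a in G, ((mbic a x).2 <= mu a)%N].

(* The result of letting f act on the basis vector mu of the standard
   representation of B^G x Z^n (p lowers a coordinate and kills 0, q raises it):
   x kills mu unless [below G mu x], and otherwise x and its content determine
   the resulting basis vector. *)
Definition gen G mu : A -> pol :=
  lin (fun x => if below G mu x then mpoly.mpolyX K (content x) else 0).

(** For [G \subset arcs] this is the kernel of K[M] -> K[B^G x Z^n]: content and unmatched openers
    determine the image of [x], and by Moebius inversion the partial sums over all bounds [mu]
    vanish only if all coefficients of the image do. *)
Definition Pideal G : set A := [set f | forall mu, gen G mu f = 0]%classic.

(* The number of openers that may remain unmatched in x so that below G mu (x y)
   holds, for y of content k; no truncation occurs if below G mu y holds. *)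
Definition shift (k : mpoly.multinom n) mu a := (mu a + closers a k - openers a k)%N.

(** The openers of [x] that survive the unmatched closers of [y] add to those of [y]. By
    [mbic_balance] the room left for [x] depends on [y] only through its content. *)
Lemma belowM G nu x y : G \subset arcs ->
  below G nu (mmul x y) = below G nu y && below G (shift (content y) nu) x.
Proof.
move=> /fintype.subsetP Ga.
apply/forall_inP/andP => [h|[/forall_inP hy /forall_inP hx] a aG].
  split; apply/forall_inP => a aG; have := h a aG; have := Ga a aG;
    rewrite inE => /(mbicM x y) ->; have := mbic_balance a y;
    rewrite /bmul /shift /=; lia.
have := hy a aG; have := hx a aG; have := Ga a aG.
rewrite inE => /(mbicM x y) ->; have := mbic_balance a y.
by rewrite /bmul /shift /=; lia.
Qed.

Lemma genM G nu f g : G \subset arcs ->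
  gen G nu (f * g) = lin (fun y => if below G nu y then
    mpoly.mpolyX K (content y) * gen G (shift (content y) nu) f else 0) g.
Proof.
move=> Ga; rewrite /gen linM; apply: lin_eq => y _.
case: ifP => hy; last first.
  rewrite /lin big1 // => x _; rewrite belowM // hy /= scaler0 //.
rewrite /lin mulr_sumr; apply: eq_bigr => x _.
rewrite belowM // hy /= -scalerAr; case: ifP; rewrite ?mulr0 // => _.
by rewrite contentM mpoly.mpolyXD mulrC.
Qed.

(** Terms are grouped by content: the coefficient of [k] in [gen G nu g] is the total weight of the
    terms of content [k] below [nu]. This makes [Pideal] stable under left multiplication. *)
Lemma lin_content G nu (F : mpoly.multinom n -> pol) g :
  lin (fun y => if below G nu y then F (content y) else 0) g
  = \sum_(k <- undup (map (@content n) (msupp g)))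
      mpoly.mcoeff k (gen G nu g) *: F k.
Proof.
rewrite /gen; under eq_bigr => k _ do
  rewrite /lin raddf_sum /= scaler_suml.
rewrite exchange_big /=; apply: eq_big_seq => y yg.
have cy : content y \in undup (map (@content n) (msupp g)).
  by rewrite mem_undup map_f.
rewrite (bigD1_seq (content y)) ?undup_uniq //= big1 ?addr0.
  rewrite mpoly.mcoeffZ; case: ifP => _; last first.
    by rewrite mpoly.mcoeff0 mulr0 scale0r scaler0.
  by rewrite mpoly.mcoeffX eqxx mulr1.
move=> k; rewrite mpoly.mcoeffZ; case: ifP => _; last first.
  by rewrite mpoly.mcoeff0 mulr0 scale0r.
by rewrite mpoly.mcoeffX eq_sym => /negPf ->; rewrite mulr0 scale0r.
Qed.

Lemma lin_content0 G nu (F : mpoly.multinom n -> pol) g : Pideal G g ->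
  lin (fun y => if below G nu y then F (content y) else 0) g = 0.
Proof.
by move=> Pg; rewrite lin_content big1 // => k _; rewrite Pg mpoly.mcoeff0 scale0r.
Qed.

Lemma Pideal_ideal G : G \subset arcs -> two_sided_ideal (Pideal G).
Proof.
move=> Ga; split.
- by move=> mu; rewrite /gen raddf0.
- by move=> f g Pf Pg mu; rewrite /gen raddfD /= [lin _ f]Pf [lin _ g]Pg addr0.
- move=> f g Pg mu; rewrite genM //.
  exact: (lin_content0 mu (fun k => mpoly.mpolyX K k * gen G (shift k mu) f)).
- move=> f g Pf mu; rewrite genM // /lin big1 // => y _.
  by rewrite Pf mulr0 if_same scaler0.
Qed.

Lemma Pideal_proper G : Pideal G <> setT.
Proof.
move=> e; have : Pideal G 1 by rewrite e.
move=> /(_ (fun a => size (repr (mone : M)))) /eqP; apply/negP.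
rewrite /gen linU scale1r; case: ifP => [_|/negP[]].
  apply/eqP => /(congr1 (mpoly.mcoeff (content (mone : M)))) /eqP.
  by rewrite mpoly.mcoeffX eqxx mpoly.mcoeff0 oner_eq0.
by apply/forall_inP => a _; apply: bic_le_size.
Qed.

Lemma Pideal_mono (G H : {set arc}) f : H \subset G -> Pideal G f -> Pideal H f.
Proof.
move=> /fintype.subsetP HG Pf mu.
(* [B] bounds every unmatched count on the support, so the coordinates outside [H] impose no
   condition. *)
pose B := \max_(x <- msupp f) size (repr x).
rewrite -[RHS](Pf (fun a => if a \in H then mu a else B)).
apply: lin_eq => x xf; congr (if _ then _ else _).
apply/forall_inP/forall_inP => h a aG; last by have := h a (HG a aG); rewrite aG.
case: ifP => aH; first exact: h.
apply: leq_trans (bic_le_size _ _) _.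
by rewrite /B (big_rem x) //= leq_maxl.
Qed.

(** Take [x] in the support with the fewest unmatched openers in total, and its own counts as bound.
    A term of the same content below this bound has the same counts, hence is [x], so the
    coefficient at [content x] is [f@_x]. *)
Lemma Pideal_arcs f : Pideal arcs f -> f = 0.
Proof.
move=> Pf; apply/eqP; rewrite -msupp_eq0; apply/negPn/negP => /fset0Pn[x0 x0f].
pose wt x := (\sum_(a in arcs) (mbic a x).2)%N.
have : exists m, has (fun x => wt x == m) (msupp f).
  by exists (wt x0); apply/hasP; exists x0.
case/ex_minnP => m /hasP[{x0f} x x_f /eqP wx] min_m.
have := Pf (fun a => (mbic a x).2) => /(congr1 (mpoly.mcoeff (content x))).
rewrite mpoly.mcoeff0 /gen /lin raddf_sum /= (bigD1_seq x) ?fset_uniq //= big1_seq.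
  rewrite addr0 mpoly.mcoeffZ ifT; last by apply/forall_inP.
  by rewrite mpoly.mcoeffX eqxx mulr1 => /eqP; rewrite mcoeff_eq0 x_f.
move=> y /andP[yx y_f]; rewrite mpoly.mcoeffZ.
case: ifP => [/forall_inP le_yx|_]; last by rewrite mpoly.mcoeff0 mulr0.
rewrite mpoly.mcoeffX; case: eqP => [eq_c|_]; last by rewrite mulr0.
case/eqP: yx; apply: mbic_faithful => // a lt_a.
have le_xy : (wt x <= wt y)%N by rewrite wx min_m //; apply/hasP; exists y.
have a_arc : a \in arcs by rewrite inE.
have wtE z : wt z = ((mbic a z).2 + \sum_(i in arcs | i != a) (mbic i z).2)%N.
  by rewrite /wt (bigD1 a).
move: le_xy; rewrite !wtE.
have : (\sum_(i in arcs | i != a) (mbic i y).2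
        <= \sum_(i in arcs | i != a) (mbic i x).2)%N.
  by apply: leq_sum => i /andP[/le_yx].
have := le_yx a a_arc; lia.
Qed.

End GeneratingPolynomials.

(** * Words attached to nested families of arcs *)

Section NestedFamilies.
Variable n : nat.
Local Notation arc := ('I_n * 'I_n)%type.
Implicit Types (a b c p q : arc) (C : {set arc}).

Definition inside p q := (q.1 < p.1) && (p.2 < q.2).

Lemma not_inside p q : ~~ (inside p q || inside q p) ->
  p.1 <= q.1 /\ p.2 <= q.2 \/ q.1 <= p.1 /\ q.2 <= p.2.
Proof. by rewrite /inside; lia. Qed.

Definition chain C := (C \subset arcs n) &&
  [forall p in C, forall q in C, (p == q) || inside p q || inside q p].

Lemma chain_arc C a : chain C -> a \in C -> a.1 < a.2.
Proof. by case/andP => /fintype.subsetP Ca _ /Ca; rewrite inE. Qed.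

Lemma chain_cmp C p q : chain C -> p \in C -> q \in C ->
  [\/ p = q, inside p q | inside q p].
Proof.
case/andP => _ /forall_inP/(_ p) h pC; move/forall_inP: (h pC) => {}h /h.
by case/orP => [/orP[/eqP ->|i]|i]; [apply: Or31 | apply: Or32 | apply: Or33].
Qed.

Lemma leftmost_arc (P : pred arc) a0 : P a0 ->
  exists2 a, P a & forall b, P b -> a.1 <= b.1.
Proof.
by move=> Pa0; case: (arg_minnP (fun a : arc => val a.1) Pa0) => a Pa min_a; exists a.
Qed.

Lemma unit_words C c : chain C -> c \in C -> exists u v, forall a, a \in C ->
  bic a u = (0, nat_of_bool (a == c)) /\ bic a v = (nat_of_bool (a == c), 0).
Proof.
move=> chC cC; have lt_c := chain_arc chC cC.
have cmp a : a \in C -> [\/ a = c, inside a c && (a != c) | inside c a && (a != c)].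
  move=> aC; have [->|] := eqVneq a c; first exact: Or31.
  move=> /eqP ne; case: (chain_cmp chC aC cC) => // i;
    [apply: Or32 | apply: Or33]; rewrite i; exact/eqP.
case: (pickP [pred d in C | inside d c]) => [d0 dP|none]; last first.
  exists [:: c.2], [:: c.1] => a aC; have := chain_arc chC aC.
  case: (cmp a aC) => [->|/andP[i _]|/andP[/andP[h1 h2] /negPf ->]].
  - by rewrite eqxx /bic /bic_letter /bmul /= => lt; split; congr pair; lia.
  - by have := none a; rewrite /= aC i.
  - by rewrite /bic /bic_letter /bmul /= => lt; split; congr pair; lia.
have [d /andP[dC /andP[h1 h2]] min_d] := leftmost_arc dP.
have lt_d := chain_arc chC dC.
(* Here [d] is the outermost arc inside [c]. The letters [d.1] and [d.2] are neutral for [c] and for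
   the arcs around it; on the arcs inside [c] they cancel the effect of [c.2] and [c.1]. *)
exists [:: c.2; d.1], [:: d.2; c.1] => a aC; have lt_a := chain_arc chC aC.
case: (cmp a aC) => [->|/andP[ia /negPf ->]|/andP[/andP[h3 h4] /negPf ->]].
- by rewrite eqxx /bic /bic_letter /bmul /=; split; congr pair; lia.
- have le_da : d.1 <= a.1 by apply: min_d; rewrite /= aC.
  have le_ad : a.2 <= d.2.
    by case: (chain_cmp chC aC dC) => [->|/andP[]|/andP[]] //; lia.
  by case/andP: ia => h3 h4; rewrite /bic /bic_letter /bmul /=; split; congr pair; lia.
- by rewrite /bic /bic_letter /bmul /=; split; congr pair; lia.
Qed.

Lemma bic_nseq_openers a w k (b : nat) : bic a w = (0, b) ->
  bic a (flatten (nseq k w)) = (0, k * b).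
Proof.
move=> e; elim: k => //= k; rewrite bic_cat e /bmul => -> /=.
by congr pair; lia.
Qed.

Lemma bic_nseq_closers a w k (b : nat) : bic a w = (b, 0) ->
  bic a (flatten (nseq k w)) = (k * b, 0).
Proof.
move=> e; elim: k => //= k; rewrite bic_cat e /bmul => -> /=.
by congr pair; lia.
Qed.

Lemma word_exists C (mu la : arc -> nat) : chain C ->
  exists w, forall a, a \in C -> bic a w = (mu a, la a).
Proof.
move=> chC.
have [u [v uv]] : exists u v, forall a, a \in C ->
    bic a u = (0, if a \in enum C then la a else 0) /\
    bic a v = (if a \in enum C then mu a else 0, 0).
  have : {subset enum C <= C} by move=> a; rewrite mem_enum.
  elim: (enum C) (enum_uniq C) => [_ _|c s IH /= /andP[cs us] sC].
    by exists [::], [::].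
  have [|u [v uv]] := IH us; first by move=> a as_; apply: sC; rewrite inE as_ orbT.
  have cC : c \in C by apply: sC; rewrite mem_head.
  have [u' [v' uv']] := unit_words chC cC.
  exists (flatten (nseq (la c) u') ++ u), (v ++ flatten (nseq (mu c) v')) => a aC.
  have [eu ev] := uv a aC; have [eu' ev'] := uv' a aC.
  rewrite !bic_cat eu ev (bic_nseq_openers _ eu') (bic_nseq_closers _ ev') /bmul /= inE.
  case: eqP => [->|_] /=; rewrite ?(negPf cs) ?muln0 ?muln1.
    by split; congr pair; lia.
  by split; congr pair; case: ifP => _; lia.
(* Closers stand to the left of openers, so nothing cancels. *)
exists (v ++ u) => a aC; have [eu ev] := uv a aC.
by rewrite bic_cat eu ev mem_enum aC /bmul /=; congr pair; lia.
Qed.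

(** Swapping the letters [c.2] and [c.1] changes the coordinate [c], and otherwise only those of
    arcs weakly inside [c]. An extra letter, neutral for [c], hides the swap from such arcs in
    [C]. *)
Lemma separating_words C c : chain C -> c.1 < c.2 -> c \notin C -> exists u v,
  [/\ perm_eq u v, (forall a, a \in C -> bic a u = bic a v)
    & (bic c u).2 < (bic c v).2].
Proof.
move=> chC lt_c cC.
case: (pickP [pred d : arc | [&& d \in C, c.1 <= d.1 & d.2 <= c.2]])
  => [d0 dP|none]; last first.
  exists [:: c.2; c.1], [:: c.1; c.2]; split; first by apply/permP => p /=; lia.
    move=> a aC; have := chain_arc chC aC; have := none a; rewrite /= aC /=.
    by move=> h lt_a; rewrite /bic /bic_letter /bmul /=; congr pair; lia.
  by rewrite /bic /bic_letter /bmul /=; lia.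
have [d /and3P[dC h1 h2] min_d] := leftmost_arc dP.
have lt_d := chain_arc chC dC.
case: (ltnP d.2 c.2) => h3.
  (* Arcs of [C] weakly inside [c] are [d] or lie inside [d]. They read [d.2] as an opener, and p p
     q = p q p. *)
  exists [:: d.2; c.2; c.1], [:: d.2; c.1; c.2]; split; first by apply/permP => p /=; lia.
    move=> a aC; have lt_a := chain_arc chC aC.
    have := min_d a; rewrite /= aC /= => md.
    have {md} : [/\ a.1 < d.2, a.2 <= d.2 -> c.1 <= a.1
        & a.1 < c.1 \/ c.1 <= a.1 /\ a.2 <= d.2 \/ c.2 < a.2].
      by case: (chain_cmp chC aC dC) => [->|/andP[h4 h5]|/andP[h4 h5]]; split; lia.
    move=> [h4 h5 h6]; rewrite /bic /bic_letter /bmul /=.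
    case: (leqP d.2 a.1) => e1; case: (leqP c.2 a.1) => e2; case: (leqP c.1 a.1) => e3;
      case: (leqP a.2 d.2) => e4; case: (leqP a.2 c.2) => e5; case: (leqP a.2 c.1) => e6 //;
      exfalso; lia.
  by rewrite /bic /bic_letter /bmul /=; lia.
have h4 : c.1 < d.1.
  rewrite ltn_neqAle h1 andbT; apply: contraNneq cC => e.
  rewrite (_ : c = d) // [c]surjective_pairing [d]surjective_pairing.
  by congr pair; apply: val_inj => //=; lia.
(* Dually, those arcs read [d.1] as a closer, and p q q = q p q. *)
exists [:: c.2; c.1; d.1], [:: c.1; c.2; d.1]; split; first by apply/permP => p /=; lia.
  move=> a aC; have lt_a := chain_arc chC aC.
  have := min_d a; rewrite /= aC /= => md.
  have {md} : [/\ d.1 < a.2, d.1 <= a.1 -> a.2 <= c.2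
      & a.1 < c.1 \/ d.1 <= a.1 \/ c.2 < a.2].
    by case: (chain_cmp chC aC dC) => [->|/andP[h5 h6]|/andP[h5 h6]]; split; lia.
  move=> [h5 h6 h7]; rewrite /bic /bic_letter /bmul /=.
  case: (leqP d.1 a.1) => e1; case: (leqP c.2 a.1) => e2; case: (leqP c.1 a.1) => e3;
    case: (leqP a.2 d.1) => e4; case: (leqP a.2 c.2) => e5; case: (leqP a.2 c.1) => e6 //;
    exfalso; lia.
by rewrite /bic /bic_letter /bmul /=; lia.
Qed.

End NestedFamilies.

(** * Prime ideals *)

Lemma seq_argmax (T : eqType) (s : seq T) (F : T -> nat) : s != [::] ->
  exists2 x, x \in s & forall y, y \in s -> F y <= F x.
Proof.
elim: s => //= z [|z' s] IH _.
  by exists z => [|y]; rewrite ?mem_seq1 // => /eqP ->.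
have [//|x xs max_x] := IH; case: (leqP (F z) (F x)) => zx.
  exists x => [|y]; first by rewrite inE xs orbT.
  by rewrite inE => /orP[/eqP -> //|/max_x].
exists z => [|y]; first exact: mem_head.
rewrite inE => /orP[/eqP -> //|/max_x]; lia.
Qed.

Section Primes.
Local Open Scope ring_scope.
Variables (K : fieldType) (n : nat).
Local Notation M := (chinese_monoid n).
Local Notation A := {malg K[chinese_monoid n]}.
Local Notation arc := ('I_n * 'I_n)%type.
Implicit Types (a b : arc) (x y : M) (G C : {set arc}) (mu nu : arc -> nat).
Implicit Types (f g : A).

Lemma eq_gen G mu nu f : {in G, mu =1 nu} -> gen G mu f = gen G nu f.
Proof.
move=> e; apply: lin_eq => x _; congr (if _ then _ else _).
by apply: eq_forallb_in => a aG; rewrite e.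
Qed.

(** For each content of [y], the condition at [b] on [x] or the condition at [a] on [y] is implied
    by the others. The choice depends only on the content, so [lin_content0] still applies. *)
Lemma Pideal_mul G a b f g : G \subset arcs n -> a \in G -> b \in G -> a != b ->
  (a.1 <= b.1)%N -> (a.2 <= b.2)%N ->
  Pideal (G :\ b) f -> Pideal (G :\ a) g -> Pideal G (f * g).
Proof.
move=> Ga aG bG ab h1 h2 Pf Pg mu; rewrite genM //.
pose F k := mpoly.mpolyX K k * gen G (shift k mu) f.
rewrite -[RHS](lin_content0 mu F Pg); apply: lin_eq => y _; rewrite -/(F _).
(* By [bic_mono], [x] has at most as many unmatched openers for [b] as for [a]; here the bound at
   [b] is redundant and [f] contributes 0. *)
case: (leqP (shift (content y) mu a) (shift (content y) mu b)) => hs.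
  rewrite (_ : F _ = 0) ?if_same // /F -[X in _ * X = _](_ : 0 = _) ?mulr0 //.
  rewrite -(Pf (shift (content y) mu)); apply: lin_eq => x _.
  congr (if _ then _ else _); apply/forall_inP/forall_inP => h c.
    move=> cG; have [->|cb] := eqVneq c b; last by apply: h; rewrite !inE cb.
    have := h a; rewrite !inE ab => /(_ aG) ha.
    by have [_] := bic_mono (repr x) h1 h2; rewrite -!/(mbic _ _); lia.
  by rewrite !inE => /andP[_]; apply: h.
(* Now the bound at [a] on [y] is redundant: the shift at [b] is at least the number of unmatched
   closers of [y] for [b], hence for [a], and the shift at [a] is larger still. *)
congr (if _ then _ else _); apply/forall_inP/forall_inP => h c.
  by rewrite !inE => /andP[_]; apply: h.
move=> cG; have [->|ca] := eqVneq c a; last by apply: h; rewrite !inE ca.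
have := h b; rewrite !inE eq_sym ab => /(_ bG) hb.
have [h3 _] := bic_mono (repr y) h1 h2; move: h3; rewrite -!/(mbic _ _).
have := mbic_balance a y; have := mbic_balance b y.
by move: hs; rewrite /shift; lia.
Qed.

(** In a smallest family [C] with P(C) contained in [Q], a non-nested pair would allow one arc to be
    dropped by [Pideal_mul]. *)
Lemma prime_contains_chain (Q : set A) : prime_ideal Q ->
  exists2 C, chain C & (Pideal C `<=` Q)%classic.
Proof.
case=> idQ _ mulQ.
pose P (G : {set arc}) := (G \subset arcs n) && `[< Pideal G `<=` Q >]%classic.
have P0 : P (arcs n).
  rewrite /P fintype.subxx; apply/asboolP => f /Pideal_arcs ->.
  exact: (ideal0 idQ).
case: (arg_minnP (fun G : {set arc} => #|G|) P0) => C /andP[Ca /asboolP PC] min_C.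
exists C => //; rewrite /chain Ca; apply/forall_inP => a aC; apply/forall_inP => b bC.
have [//|ab /=] := eqVneq a b; apply/negPn/negP => nest.
have drop p q : p \in C -> q \in C -> p != q -> (p.1 <= q.1)%N -> (p.2 <= q.2)%N -> False.
  move=> pC qC pq h1 h2.
  have no r : r \in C -> ~ (Pideal (C :\ r) `<=` Q)%classic.
    move=> rC sub; have := min_C (C :\ r).
    rewrite /P (fintype.subset_trans (subD1set _ _) Ca).
    move=> /(_ (introT (asboolP _) sub)).
    by rewrite (cardsD1 r C) rC add1n ltnn.
  have Cr r : C :\ r \subset arcs n by apply: fintype.subset_trans Ca; apply: subD1set.
  have [] := mulQ (Pideal (C :\ q)) (Pideal (C :\ p)); last 1 first.
  - exact: no.
  - exact: Pideal_ideal.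
  - exact: Pideal_ideal.
  - by move=> f g Pf Pg; apply/PC/(Pideal_mul Ca pC qC).
  exact: no.
have ba : b != a by rewrite eq_sym.
by case: (not_inside nest) => -[h1 h2]; [apply: (drop a b) | apply: (drop b a)].
Qed.

Lemma Pideal_chain_sub C G : chain C -> G \subset arcs n ->
  (Pideal C `<=` (Pideal G : set A))%classic -> G \subset C.
Proof.
move=> chC Ga sub; apply/fintype.subsetP => c cG; apply/negPn/negP => cC.
have lt_c : (c.1 < c.2)%N by have := fintype.subsetP Ga c cG; rewrite inE.
have [u [v [puv uvC uv_c]]] := separating_words chC lt_c cC.
pose x : M := (\pi u)%qT; pose y : M := (\pi v)%qT.
have eq_c : content x = content y.
  by apply/mpoly.mnmP => i; rewrite !content_pi; apply/permP.
have Pxy : Pideal C (<< x >> - << y >> : A).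
  move=> mu; rewrite /gen raddfB /= !linU eq_c.
  rewrite (_ : below C mu x = below C mu y) ?subrr //.
  apply: eq_forallb_in => a aC.
  by rewrite !mbic_pi ?(chain_arc chC aC) // uvC.
(* The bound is exact at [c] and vacuous for [u] elsewhere, so [x] survives while [y] is killed at
   [c]. *)
have /eqP := sub _ Pxy (fun a => if a == c then (bic c u).2 else size u).
rewrite /gen raddfB /= !linU !scale1r ifT; last first.
  apply/forall_inP => a aG; have := fintype.subsetP Ga a aG; rewrite inE => lt_a.
  by rewrite mbic_pi //; case: eqP => [-> //|_]; apply: bic_le_size.
rewrite ifF ?subr0; last first.
  apply/negbTE/negP => /forall_inP/(_ c cG); rewrite eqxx mbic_pi // leqNgt.
  by rewrite uv_c.
apply/negP/eqP => /(congr1 (mpoly.mcoeff (content x))) /eqP.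
by rewrite mpoly.mcoeffX eqxx mpoly.mcoeff0 oner_eq0.
Qed.

Lemma notin_Pideal C f : ~ Pideal C f -> exists mu, gen C mu f != 0.
Proof. by move/existsNP => [mu /eqP Pf]; exists mu. Qed.

(* Multiplying g on the left by a word that lowers by the largest shift occurring
   in [gen C nu g] kills the terms with another shift; the surviving terms are
   then raised to mu, where f acts nontrivially. *)
Lemma Pideal_prime_elt C f g : chain C -> ~ Pideal C f -> ~ Pideal C g ->
  exists w : M, ~ Pideal C (f * << w >> * g).
Proof.
move=> chC /notin_Pideal[mu nz_f] /notin_Pideal[nu nz_g].
have Ca : C \subset arcs n by case/andP: chC.
pose cs := undup (map (@content n) (msupp g)).
pose cf k : K := mpoly.mcoeff k (gen C nu g).
have [k0] : exists2 k, k \in [seq k <- cs | cf k != 0] &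
    forall k', k' \in [seq k <- cs | cf k != 0] ->
    (\sum_(a in C) shift k' nu a <= \sum_(a in C) shift k nu a)%N.
  apply: seq_argmax; apply: contraNneq nz_g => e0; apply/eqP.
  rewrite {1}/gen (lin_content C nu (fun k => mpoly.mpolyX K k)) big1_seq //.
  move=> k /= kcs; rewrite -/(cf k).
  have [->|nz_k] := eqVneq (cf k) 0; first by rewrite scale0r.
  by have : k \in [::] by rewrite -e0 mem_filter nz_k.
rewrite mem_filter => /andP[nz_k0 k0cs] max_k0.
pose la := shift k0 nu.
have [u eu] := word_exists mu la chC.
pose w : M := (\pi u)%qT.
have ew a : a \in C -> mbic a w = (mu a, la a).
  by move=> aC; rewrite mbic_pi ?eu // (chain_arc chC aC).
exists w => /(_ nu).
rewrite -mulrA genM // linM.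
pose good k := [forall a in C, (la a <= shift k nu a)%N].
pose F k := if good k then mpoly.mpolyX K (mpoly.mnm_add (content w) k)
  * gen C (fun a => shift k nu a - la a + mu a)%N f else 0.
rewrite (_ : lin _ g =
  lin (fun y => if below C nu y then F (content y) else 0) g); last first.
  apply: lin_eq => y _; rewrite linU scale1r belowM //.
  case: ifP => /= [/andP[by_ bw]|]; last first.
    by case: (below C nu y) => //= nbw; rewrite /F ifF // -nbw;
      apply: eq_forallb_in => a aC; rewrite ew.
  rewrite by_ /F ifT; last first.
    by apply/forall_inP => a aC; have := forall_inP bw a aC; rewrite ew.
  rewrite contentM; congr (_ * _); apply: eq_gen => a aC.
  have := forall_inP by_ a aC; have := forall_inP bw a aC; rewrite ew //=.
  have := mbic_balance a y; have := mbic_balance a (mmul w y).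
  have lt_a := chain_arc chC aC.
  rewrite mbicM // ew // contentM /bmul /shift /=; lia.
rewrite lin_content -/cs.
(* If [k] is good with nonzero coefficient, its shift dominates [la] on [C] but has no larger sum.
   The two agree there, [f] always acts at [mu], and the sum factors. *)
rewrite (_ : (\sum_(k <- cs) _) =
  (\sum_(k <- cs) if good k then cf k *: mpoly.mpolyX K k else 0)
  * (mpoly.mpolyX K (content w) * gen C mu f)); last first.
  rewrite mulr_suml; apply: eq_big_seq => k kcs; rewrite -/(cf k) /F.
  have [->|nz_k] := eqVneq (cf k) 0; first by rewrite !scale0r if_same mul0r.
  case: ifP => [/forall_inP gk|_]; last by rewrite scaler0 mul0r.
  rewrite mpoly.mpolyXD -scalerAl !mulrA [mpoly.mpolyX _ k * _]mulrC.
  congr (_ *: (_ * _)); apply: eq_gen => a aC.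
  have le_k : (\sum_(a in C) shift k nu a <= \sum_(a in C) la a)%N.
    by apply: max_k0; rewrite mem_filter nz_k.
  suff -> : shift k nu a = la a by rewrite subnn.
  have spl h : (\sum_(b in C) h b)%N = (h a + \sum_(b in C | b != a) h b)%N.
    by rewrite (bigD1 a).
  move: le_k; rewrite !spl; have := gk a aC.
  have : (\sum_(b in C | b != a) la b <= \sum_(b in C | b != a) shift k nu b)%N.
    by apply: leq_sum => b /andP[/gk].
  lia.
move/eqP; rewrite !mulf_eq0 (negPf nz_f) orbF => /orP[]; last first.
  move=> /eqP/(congr1 (mpoly.mcoeff (content w)))/eqP.
  by rewrite mpoly.mcoeffX eqxx mpoly.mcoeff0 oner_eq0.
move=> /eqP/(congr1 (mpoly.mcoeff k0))/eqP.
rewrite mpoly.mcoeff0 raddf_sum /= (bigD1_seq k0) ?undup_uniq //= big1 ?addr0.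
  rewrite ifT; last by apply/forall_inP.
  by rewrite mpoly.mcoeffZ mpoly.mcoeffX eqxx mulr1 (negPf nz_k0).
move=> k kk0; case: ifP => _; last by rewrite mpoly.mcoeff0.
by rewrite mpoly.mcoeffZ mpoly.mcoeffX (negPf kk0) mulr0.
Qed.

Lemma Pideal_prime C : chain C -> prime_ideal (Pideal C : set A).
Proof.
move=> chC; have Ca : C \subset arcs n by case/andP: chC.
split; [exact: Pideal_ideal | exact: Pideal_proper |] => I J idI idJ IJ.
apply: contrapT => /not_orP[/existsNP[f /not_implyP[If Pf]]].
move=> /existsNP[g /not_implyP[Jg Pg]].
have [w []] := Pideal_prime_elt chC Pf Pg.
by apply: IJ => //; apply: ideal_mulr.
Qed.

End Primes.

(** * Counting maximal nested families *)

(** The two sums will run over the outer arcs starting at the left end of a window of [m.+2]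
    letters, and over those touching only its right end. *)
Lemma tribonacci_sum m : \sum_(0 <= k < m.+1) tribonacci k
  + \sum_(0 <= k < m) tribonacci k = tribonacci m.+2.
Proof.
elim: m => [|m IH]; first by rewrite big_nat1 big_geq.
rewrite big_nat_recr //= [X in _ + X]big_nat_recr //= -/(tribonacci m.+2).
by move: IH; rewrite /=; lia.
Qed.

Section Counting.
Variable n : nat.
Local Notation arc := ('I_n * 'I_n)%type.
Implicit Types (p q : arc) (C D E : {set arc}) (i j : nat).

(** The window is half-open, so the arcs strictly inside [p] are those of the window from [p.1.+1]
    to [p.2]. *)
Definition wchain i j C :=
  chain C && [forall p in C, (i <= p.1) && (p.2 < j)].

Definition maxchains i j := [set C : {set arc} | maxset (wchain i j) C].

Definition outer i j := [set p : arc |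
  [&& i <= p.1, p.1 < p.2, p.2 < j & (p.1 == i :> nat) || (p.2.+1 == j)]].

Definition top p C := (p \in C) && [forall q in C, (q == p) || inside q p].

Lemma wchainP i j C : reflect
  [/\ forall p, p \in C -> p.1 < p.2,
      forall p q, p \in C -> q \in C -> (p == q) || inside p q || inside q p
    & forall p, p \in C -> i <= p.1 /\ p.2 < j] (wchain i j C).
Proof.
apply: (iffP idP) => [/andP[chC /forall_inP w]|[h1 h2 h3]].
  split; last by move=> p /w/andP.
    by move=> p; apply: chain_arc.
  move=> p q pC qC.
  by case: (chain_cmp chC pC qC) => [->|->|->]; rewrite ?eqxx ?orbT.
rewrite /wchain /chain -andbA; apply/and3P; split.
- by apply/fintype.subsetP => p /h1; rewrite inE.
- by apply/forall_inP => p pC; apply/forall_inP => q; apply: h2.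
- by apply/forall_inP => p /h3[-> ->].
Qed.

Lemma wchain_sub i j C D : D \subset C -> wchain i j C -> wchain i j D.
Proof.
by move=> /fintype.subsetP DC /wchainP[h1 h2 h3]; apply/wchainP; split;
  auto => p q /DC pC /DC qC; apply: h2.
Qed.

Lemma wchain_top i j p D : i <= p.1 -> p.1 < p.2 -> p.2 < j ->
  wchain p.1.+1 p.2 D -> wchain i j (p |: D) /\ p \notin D.
Proof.
move=> ip pp pj /wchainP[h1 h2 h3]; split; last first.
  by apply/negP => /h3; rewrite ltnn => -[].
apply/wchainP; split=> q; first by rewrite !inE => /orP[/eqP -> //|/h1].
  move=> r; rewrite !inE => /orP[/eqP ->|qD] /orP[/eqP ->|rD].
  - by rewrite eqxx.
  - by case: (h3 r rD) => a b; rewrite /inside a b !orbT.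
  - by case: (h3 q qD) => a b; rewrite /inside a b !orbT.
  - exact: h2.
by rewrite !inE => /orP[/eqP -> //|/h3]; lia.
Qed.

Lemma wchain_inner i j p C : wchain i j C -> top p C -> wchain p.1.+1 p.2 (C :\ p).
Proof.
move=> wC /andP[pC /forall_inP tp].
have /wchainP[h1 h2 h3] := wchain_sub (subD1set C p) wC.
apply/wchainP; split=> // q; rewrite !inE => /andP[qp qC].
by have := tp q qC; rewrite (negPf qp) => /andP[].
Qed.

Lemma outer_top i j p C : wchain i j C -> p \in outer i j -> p \in C -> top p C.
Proof.
move=> /wchainP[h1 h2 h3]; rewrite inE => /and4P[ip pp pj op] pC.
rewrite /top pC; apply/forall_inP => q qC.
have := h2 q p qC pC; rewrite -orbA => /or3P[->|->|]; rewrite ?orbT //.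
by case: (h3 q qC) => a b /andP[c d]; exfalso; lia.
Qed.

Lemma maxchain_top i j C : i.+1 < j -> j <= n -> C \in maxchains i j ->
  exists2 p, p \in outer i j & top p C.
Proof.
move=> ij jn; rewrite inE => /maxsetP[wC maxC].
have i_n : i < n by lia.
have j_n : j.-1 < n by lia.
pose e : arc := (Ordinal i_n, Ordinal j_n).
(* Otherwise the arc [e] joining both ends of the window could be added to [C]. *)
have notU : (forall q, q \in C -> inside q e) -> False.
  move=> ins; have wD : wchain i.+1 j.-1 C.
    have /wchainP[h1 h2 h3] := wC.
    by apply/wchainP; split=> // q /ins/andP.
  have [|||wE] := @wchain_top i j e C _ _ _ wD; rewrite /= ?leqnn //; try lia.
  by rewrite -(maxC _ wE (subsetU1 _ _)) setU11.
have /wchainP[h1 h2 h3] := wC.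
have [p0 p0C] : exists p, p \in C.
  by apply/set0Pn/eqP => C0; apply: notU => q; rewrite C0 inE.
have [p /= pC min_p] := leftmost_arc (p0C : [pred p | p \in C] p0).
have tp : top p C.
  rewrite /top pC; apply/forall_inP => q qC.
  have := h2 q p qC pC; rewrite -orbA => /or3P[->|->|]; rewrite ?orbT //.
  by have := min_p q qC; rewrite /inside; lia.
exists p => //; rewrite inE h1 //; case: (h3 p pC) => -> pj; rewrite pj /=.
apply/negPn/negP => nout; apply: notU => q qC.
move: nout; rewrite negb_or => /andP[n1 n2].
have := min_p q qC; have [hq1 hq2] := h3 q qC; have [hp1 hp2] := h3 p pC.
have /andP[_ /forall_inP/(_ q qC)] := tp.
by case/orP => [/eqP ->|/andP[]]; rewrite /inside /=; lia.
Qed.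

(** An arc touching an end of the window is outermost in every family containing it, so enlarging
    [C] amounts to enlarging [C :\ p] in the inner window. *)
Lemma maxchains_top i j p : p \in outer i j ->
  [set C in maxchains i j | top p C] = [set p |: D | D in maxchains p.1.+1 p.2].
Proof.
move=> pout; have := pout; rewrite inE => /and4P[ip pp pj _].
apply/setP => C; rewrite !inE; apply/andP/imsetP => [[/maxsetP[wC maxC] tp]|[D]].
  have pC : p \in C by case/andP: tp.
  exists (C :\ p); last by rewrite finset.setD1K.
  rewrite inE; apply/maxsetP; split; first exact: wchain_inner wC tp.
  move=> E wE DE; have [wpE pE] := wchain_top ip pp pj wE.
  have := maxC _ wpE; rewrite -{1}(finset.setD1K pC) finset.setUS // => /(_ isT) <-.
  by rewrite finset.setU1K.
rewrite inE => /maxsetP[wD maxD] ->; have [wpD pD] := wchain_top ip pp pj wD.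
split; last by apply: outer_top wpD pout _; rewrite setU11.
apply/maxsetP; split=> // E wE DE.
have pE : p \in E by apply: (fintype.subsetP DE); rewrite setU11.
have := maxD _ (wchain_inner wE (outer_top wE pout pE)).
rewrite finset.subsetD1 pD (fintype.subset_trans (finset.subsetUr _ _) DE) => /(_ isT) <-.
by rewrite finset.setD1K.
Qed.

Lemma sum_ord_between (F : nat -> nat) i j : j <= n ->
  \sum_(t : 'I_n | (i < t) && (t < j)) F t
  = \sum_(0 <= k < j - i.+1) F (k + i.+1).
Proof.
move=> jn; rewrite -(big_addn 0 j i.+1 xpredT F) add0n.
rewrite (big_nat_widen _ _ _ _ _ jn) big_geq_mkord.
by apply: eq_bigl => t; rewrite andbC.
Qed.

Lemma sum_outer i j : i.+1 < j -> j <= n ->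
  \sum_(p in outer i j) tribonacci (p.2 - p.1.+1) = tribonacci (j - i).
Proof.
move=> ij jn.
have i_n : i < n by lia.
have j_n : j.-1 < n by lia.
rewrite (bigID (fun p : arc => p.1 == i :> nat)) /=.
rewrite (reindex_onto (fun t => (Ordinal i_n, t)) snd) /=; last first.
  by move=> [s t] /= /andP[_ /eqP e]; congr pair; apply: val_inj.
rewrite [X in _ + X](reindex_onto (fun s => (s, Ordinal j_n)) fst) /=; last first.
  move=> [s t] /= /andP[]; rewrite inE => /and4P[_ _ _ h] h'.
  congr pair; apply: val_inj => /=.
  by move: h; rewrite (negPf h') /= => /eqP; lia.
rewrite (eq_bigl (fun t : 'I_n => (i < t) && (t < j))); last first.
  by move=> t; rewrite inE !eqxx /=; lia.
rewrite [X in _ + X](eq_bigl (fun t : 'I_n => (i < t) && (t < j.-1))); last first.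
  by move=> t; rewrite inE !eqxx /=; lia.
rewrite (sum_ord_between (fun t => tribonacci (t - i.+1)) i jn).
rewrite (sum_ord_between (fun t => tribonacci (j.-1 - t.+1)) i (ltnW j_n)).
rewrite [X in _ + X]big_nat_rev /=.
rewrite -[j - i](_ : (j - i.+2).+2 = _); last by lia.
rewrite -tribonacci_sum; congr addn.
  rewrite (_ : j - i.+1 = (j - i.+2).+1); last by lia.
  by apply: eq_big_nat => k _; congr tribonacci; lia.
rewrite (_ : j.-1 - i.+1 = j - i.+2); last by lia.
by apply: eq_big_nat => k hk; congr tribonacci; lia.
Qed.

Lemma top_uniq p q C : top p C -> top q C -> p = q.
Proof.
move=> /andP[pC /forall_inP tp] /andP[qC /forall_inP tq]; apply/eqP.
have := tp q qC; have := tq p pC; rewrite [q == p]eq_sym.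
by case: eqP => //= _; rewrite /inside; lia.
Qed.

Lemma card_maxchains i j : j <= n -> #|maxchains i j| = tribonacci (j - i).
Proof.
move em: (j - i) => m; elim/ltn_ind: m i j em => m IH i j em jn.
(* A window of at most one letter carries no arc: only the empty family remains, and T_0 = T_1 =
   1. *)
case: (ltnP i.+1 j) => ij; last first.
  have -> : maxchains i j = [set finset.set0].
    apply/setP => C; rewrite !inE; apply/maxsetP/eqP => [[/wchainP[h1 _ h3] _]|->].
      by apply/eqP; rewrite -finset.subset0; apply/fintype.subsetP => p pC;
        have := h1 p pC; have := h3 p pC; lia.
    split; first by apply/wchainP; split=> p; rewrite inE.
    move=> D /wchainP[h1 _ h3] _; apply/eqP; rewrite -finset.subset0.
    by apply/fintype.subsetP => p pD; have := h1 p pD; have := h3 p pD; lia.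
  have m_le1 : m <= 1 by lia.
  by rewrite cards1; case: (m) m_le1 => [|[]].
rewrite -em -sum_outer // -sum1_card.
(* Each maximal family is counted once, through its unique outermost arc. *)
transitivity (\sum_(C in maxchains i j) \sum_(p in outer i j | top p C) 1).
  apply: eq_bigr => C /(maxchain_top ij jn)[p pout tp].
  rewrite (big_pred1 p) // => q; apply/andP/eqP => [[_ tq]|->] //.
  exact: top_uniq tq tp.
rewrite (exchange_big_dep (mem (outer i j))) /=; last by move=> C p _ /andP[].
apply: eq_bigr => p pout.
rewrite (eq_bigl (fun C => C \in [set C in maxchains i j | top p C])); last first.
  by move=> C; rewrite pout [RHS]inE.
rewrite sum1_card maxchains_top // card_in_imset.
  have := pout; rewrite inE => /and4P[ip pp pj _].
  by apply: (IH (p.2 - p.1.+1)) => //; lia.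
have notin C : C \in maxchains p.1.+1 p.2 -> p \notin C.
  rewrite inE => /maxsetP[/wchainP[_ _ h] _]; apply/negP => /h; lia.
by move=> C D /notin pC /notin pD e; rewrite -(finset.setU1K pC) e finset.setU1K.
Qed.

Lemma maxset_chainE C : (C \in maxchains 0 n) = maxset (@chain n) C.
Proof.
have wE D : wchain 0 n D = chain D.
  rewrite /wchain andbC; case: forall_inP => // -[] p _.
  by rewrite leq0n ltn_ord.
rewrite inE; apply/maxsetP/maxsetP => -[w m]; split; rewrite -?wE // ?wE //.
  by move=> D; rewrite -wE; apply: m.
by move=> D; rewrite wE; apply: m.
Qed.

End Counting.

(** * Minimal primes and maximal nested families *)

Section Minimal.
Variables (K : fieldType) (n : nat).
Local Notation A := {malg K[chinese_monoid n]}.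
Implicit Types C D : {set 'I_n * 'I_n}.

Lemma chain_arcs C : chain C -> C \subset arcs n.
Proof. by case/andP. Qed.

Lemma Pideal_maxchain_sub C D : chain C -> maxset (@chain n) D ->
  (Pideal C `<=` (Pideal D : set A))%classic -> C = D.
Proof.
move=> chC /maxsetP[chD maxD] sub; apply: maxD => //.
exact: Pideal_chain_sub chC (chain_arcs chD) sub.
Qed.

Lemma minimal_prime_maxchain (P : set A) : minimal_prime_ideal P <->
  exists2 C, maxset (@chain n) C & P = Pideal C.
Proof.
split=> [[primeP minP]|[C maxC ->]].
  have [D chD DP] := prime_contains_chain primeP.
  have [C maxC DC] := maxset_exists chD.
  have chC : chain C by case/maxsetP: maxC.
  exists C => //; apply/esym/minP; first exact: Pideal_prime.
  by move=> f /(Pideal_mono DC)/DP.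
have chC : chain C by case/maxsetP: maxC.
split=> [|Q primeQ QC]; first exact: Pideal_prime.
have [D chD DQ] := prime_contains_chain primeQ.
have eDC : D = C by apply: Pideal_maxchain_sub => // f /DQ/QC.
by rewrite eDC in DQ; apply/seteqP.
Qed.

End Minimal.

Theorem theorem3p2p2 (K : fieldType) (n : nat) (hn : 1 <= n) :
  ([set P : set {malg K[chinese_monoid n]} | minimal_prime_ideal P]
     #= `I_(tribonacci n))%card%classic.
Proof.
have maxE C : (C \in enum (maxchains n 0 n)) = maxset (@chain n) C.
  by rewrite mem_enum maxset_chainE.
have sz : size (enum (maxchains n 0 n)) = tribonacci n.
  by rewrite -cardE card_maxchains // subn0.
(* The default is never reached, as only indices below [tribonacci n] occur. *)
pose C i := nth finset.set0 (enum (maxchains n 0 n)) i.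
have maxC i : i < tribonacci n -> maxset (@chain n) (C i).
  by move=> i_lt; rewrite -maxE mem_nth // sz.
rewrite (_ : [set P | _]%classic =
  [set (Pideal (C i) : set {malg K[chinese_monoid n]}) | i in `I_(tribonacci n)]%classic).
  apply: inj_card_eq => i j /set_mem /= i_lt /set_mem /= j_lt e.
  have /eqP : C i = C j.
    apply: (@Pideal_maxchain_sub K); [|exact: maxC|by rewrite e].
    by case/maxsetP: (maxC i i_lt).
  by rewrite nth_uniq ?sz ?enum_uniq // => /eqP.
apply/seteqP; split=> [P /minimal_prime_maxchain[D maxD ->]|_ [i i_lt <-]] /=.
  have Ds : D \in enum (maxchains n 0 n) by rewrite maxE.
  exists (index D (enum (maxchains n 0 n))); last by rewrite /C nth_index.
  by rewrite /= -sz index_mem.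
by apply/minimal_prime_maxchain; exists (C i) => //; apply: maxC.
Qed.
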